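(* Let $C$ be a normal cone with nonempty interior $\operatorname{int}C$ in a real Banach space $(X,\|\cdot\|)$. Let $G$ be an open subset of $(X,\|\cdot\|)$ included in $C$, and let $f:G\to\operatorname{int}C$ be a nonexpansive map with respect to Thompson's metric $\bar d$ (i.e. $\bar d(f(x),f(y))\le\bar d(x,y)$ for all $x,y\in G$). Let $v\in G$ be a fixed point of $f$: $f(v)=v$. Assume: (A1) $f$ is semidifferentiable at $v$, with semidifferential $f'_v:X\to X$; (A2) the map $\mathrm{Id}-f'_v:X\to X$ has Property (F); (A3) the fixed point of $f'_v:X\to X$ is unique: if $x\in X$ and $f'_v(x)=x$, then $x=0$. Then the fixed point of $f$ in $G$ is unique: if $w\in G$ and $f(w)=w$, then $w=v$.
   Context: Cones: a subset $C\subset X$ is a cone if $tC\subset C$ for all $t\ge0$. It is proper if it is closed, convex and pointed ($C\cap(-C)=\{0\}$); it then defines the partial order $x\le y\iff y-x\in C$. It is normal if it is proper and there is a constant $M$ with $\|x\|\le M\|y\|$ whenever $0\le x\le y$. Thompson's metric: for $x,y\in\operatorname{int}C$, let $M(y/x)=\inf\{b\in\mathbb R\mid y\le bx\}$ and $m(y/x)=\sup\{a\in\mathbb R\mid ax\le y\}$; then $\bar d(x,y)=\max(\log M(y/x),-\log m(y/x))$. Semidifferentiability: let $G\subset X$ and $v$ an interior point of $G$. A map $f:G\to X$ is semidifferentiable at $v$ if there exists a continuous, positively homogeneous map $h:X\to X$ (i.e. $h(tx)=th(x)$ for all $t>0$, $x\in X$) such that $f(v+x)=f(v)+h(x)+o(\|x\|)$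 as $x\to0$. Such $h$ is unique and denoted $f'_v$ (the semidifferential of $f$ at $v$). Property (F): a map $g:D\to Y$, with $D\subset X$ and $X,Y$ Banach spaces, has Property (F) if every sequence $(x_j)_{j\ge1}$ in $D$ that is bounded in $X$ and satisfies $g(x_j)\to0$ has a subsequence that converges in $X$. *)

(* Defs.v *)
From HB Require Import structures.
From mathcomp Require Import all_boot all_order all_algebra.
From mathcomp Require Import all_classical all_reals all_analysis.

Set Implicit Arguments.
Unset Strict Implicit.
Unset Printing Implicit Defensive.

Import Order.TTheory GRing.Theory Num.Theory.
Import numFieldNormedType.Exports.

Local Open Scope classical_set_scope.
Local Open Scope ring_scope.

Definition is_cone (R : realType) (X : normedModType R) (C : set X) : Prop :=
  forall (t : R) (x : X), 0 <= t -> C x -> C (t *: x).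

Definition pointed_cone (R : realType) (X : normedModType R) (C : set X) :
    Prop :=
  C `&` (-%R @` C) = [set 0].

Definition proper_cone (R : realType) (X : normedModType R) (C : set X) :
    Prop :=
  [/\ is_cone C, closed C, convex_set C & pointed_cone C].

Definition cone_le (R : realType) (X : normedModType R) (C : set X)
    (x y : X) : Prop :=
  C (y - x).

Definition normal_cone (R : realType) (X : normedModType R) (C : set X) :
    Prop :=
  proper_cone C /\
  exists M : R, forall x y : X,
    cone_le C 0 x -> cone_le C x y -> `|x| <= M * `|y|.

(* The real-valued [inf], [sup] and [ln] are total, with conventional values on
   degenerate arguments.  For x and y interior to a proper cone C in a space
   X <> 0, the sets below are nonempty and bounded on the relevant side, with
   positive inf and sup, so that no conventional value is involved. *)
Definition cone_M (R : realType) (X : normedModType R) (C : set X)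
    (y x : X) : R :=
  inf [set b : R | cone_le C y (b *: x)].

Definition cone_m (R : realType) (X : normedModType R) (C : set X)
    (y x : X) : R :=
  sup [set a : R | cone_le C (a *: x) y].

Definition thompson (R : realType) (X : normedModType R) (C : set X)
    (x y : X) : R :=
  Num.max (ln (cone_M C y x)) (- ln (cone_m C y x)).

Definition thompson_nonexpansive (R : realType) (X : normedModType R)
    (C G : set X) (f : X -> X) : Prop :=
  forall x y : X, G x -> G y -> thompson C (f x) (f y) <= thompson C x y.

Definition pos_homogeneous (R : realType) (X : normedModType R)
    (h : X -> X) : Prop :=
  forall (t : R) (x : X), 0 < t -> h (t *: x) = t *: h x.

(* [is_semidifferential G f v h]: f : G -> X is semidifferentiable at v with
   semidifferential h.  A map on G is represented by a total function; since v
   is interior to G, its values outside G play no role in the expansion. *)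
Definition is_semidifferential (R : realType) (X : normedModType R)
    (G : set X) (f : X -> X) (v : X) (h : X -> X) : Prop :=
  [/\ G° v, continuous h, pos_homogeneous h &
      f \o shift v = cst (f v) + h +o_ (0 : X) id].

Definition property_F (R : realType) (X Y : completeNormedModType R)
    (D : set X) (g : X -> Y) : Prop :=
  forall u : nat -> X,
    (forall j, D (u j)) -> bounded_fun u -> (g \o u) @ \oo --> (0 : Y) ->
    exists2 phi : nat -> nat, increasing_seq phi & cvgn (u \o phi).

(* Main.v *)
Require Import Defs.
From HB Require Import structures.
From mathcomp Require Import all_boot all_order all_algebra.
From mathcomp Require Import ring lra.
From mathcomp Require Import all_classical all_reals all_analysis.

Set Implicit Arguments.
Unset Strict Implicit.
Unset Printing Implicit Defensive.

Import Order.TTheory GRing.Theory Num.Theory.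
Import numFieldNormedType.Exports.

Local Open Scope classical_set_scope.
Local Open Scope ring_scope.

(* Suppose w <> v is another fixed point and put delta = d(v, w) > 0.  For small
   s > 0, the points z with d(v, z) <= s and d(z, w) <= delta - s form a
   nonempty, convex, f-invariant set close to v, on which the maps
   (1 - t) f + t z0 are contractions; hence f has approximate fixed points z
   there, with |z - f z| = o(s).  Since |z - v| is of order s, the rescaled
   points u = (z - v) / s are bounded, bounded away from 0, and satisfy
   u - f'v u -> 0.  By Property (F) a subsequence converges to a nonzero fixed
   point of f'v, a contradiction. *)

(** * Order calculus of a proper cone *)

Section ProperCone.
Context (R : realType) (X : normedModType R) (C : set X).
Hypothesis properC : proper_cone C.

Lemma coneZ (t : R) (x : X) : 0 <= t -> C x -> C (t *: x).
Proof. by case: properC => + _ _ _; apply. Qed.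

(** The sum is the midpoint of [2 *: x] and [2 *: y], so convexity and scaling give it. *)
Lemma coneD (x y : X) : C x -> C y -> C (x + y).
Proof.
move=> Cx Cy; case: properC => _ _ convC _.
have h0 : (0 : R) <= 2^-1 by lra.
have h1 : (2^-1 : R) <= 1 by lra.
have := convC (2 *: x) (2 *: y) (Itv01 h0 h1).
rewrite !inE => /(_ (coneZ _ Cx) (coneZ _ Cy)).
suff -> : conv (Itv01 h0 h1) (2 *: x : convex_lmodType X)
    (2 *: y : convex_lmodType X) = x + y by apply.
have e : (2^-1 * 2 : R) = 1 by lra.
have e' : ((1 - 2^-1) * 2 : R) = 1 by lra.
change (2^-1 *: (2 *: x) + (1 - 2^-1) *: (2 *: y) = x + y).
by rewrite !scalerA e e' !scale1r.
Qed.

Lemma cone_le_refl (x : X) : cone_le C x x.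
Proof.
rewrite /cone_le subrr; case: properC => _ _ _ ptC.
by have [] : (C `&` (-%R @` C)) 0 by rewrite ptC.
Qed.

Lemma cone_anti (x : X) : C x -> C (- x) -> x = 0.
Proof.
move=> Cx CNx; case: properC => _ _ _ ptC.
have : (C `&` (-%R @` C)) x by split => //; exists (- x); rewrite ?opprK.
by rewrite ptC.
Qed.

Lemma cone_le_trans (y x z : X) :
  cone_le C x y -> cone_le C y z -> cone_le C x z.
Proof.
rewrite /cone_le => xy yz.
by rewrite (_ : z - x = (z - y) + (y - x)); [exact: coneD|rewrite addrA subrK].
Qed.

Lemma cone_leD (x y x' y' : X) :
  cone_le C x y -> cone_le C x' y' -> cone_le C (x + x') (y + y').
Proof. by rewrite /cone_le opprD addrACA; exact: coneD. Qed.

Lemma cone_leN (x y : X) : cone_le C x y -> cone_le C (- y) (- x).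
Proof. by rewrite /cone_le opprK addrC. Qed.

Lemma cone_leZ (t : R) (x y : X) :
  0 <= t -> cone_le C x y -> cone_le C (t *: x) (t *: y).
Proof. by move=> t0; rewrite /cone_le -scalerBr; exact: coneZ. Qed.

Lemma cone_leZl (s t : R) (x : X) :
  s <= t -> C x -> cone_le C (s *: x) (t *: x).
Proof.
by move=> st; rewrite /cone_le -scalerBl; apply: coneZ; rewrite subr_ge0.
Qed.

Lemma cone_leZV (t : R) (x y : X) :
  0 < t -> cone_le C (t^-1 *: x) y <-> cone_le C x (t *: y).
Proof.
move=> t0; have tN0 : t != 0 by rewrite gt_eqF.
split=> h.
- by have := cone_leZ (ltW t0) h; rewrite scalerA divff// scale1r.
- have := @cone_leZ t^-1 _ _ _ h; rewrite scalerA mulVf// scale1r; apply.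
  by rewrite invr_ge0 ltW.
Qed.

Lemma cone_le_anti (x y : X) : cone_le C x y -> cone_le C y x -> x = y.
Proof.
rewrite /cone_le => yx xy; apply/subr0_eq/cone_anti => //.
by rewrite opprB.
Qed.

(** Closedness of [C], letting [b] tend to [T] from the right. This recovers the bound at an infimum
    that need not be attained. *)
Lemma cone_le_limr (T : R) (x y : X) :
  (forall b, T < b -> cone_le C x (b *: y)) -> cone_le C x (T *: y).
Proof.
move=> xy; case: properC => _ closedC _ _.
apply: (@closed_cvg _ _ (T^'+) _ (fun b => b *: y - x) C closedC).
  by near=> b; apply: xy.
apply: cvgB; last exact: cvg_cst.
by apply: cvgZr_tmp; apply: cvg_at_right_filter; exact: cvg_id.
Unshelve. all: by end_near. Qed.

Lemma interior_cone_absorb (x : X) : C° x ->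
  exists2 k : R, 0 < k & forall u : X, cone_le C u ((k * `|u|) *: x).
Proof.
move=> /nbhs_ballP[e /= e0 xC]; have k0 : 0 < 2 / e by rewrite divr_gt0.
(* For [u != 0], dividing [u] by [2 / e * |u|] gives a vector of norm [e / 2], and subtracting it
   from [x] stays in the ball inside [C]. *)
exists (2 / e) => // u.
have [->|u0] := eqVneq u 0.
  rewrite normr0 mulr0 scale0r /cone_le subr0 -(scale0r x).
  by apply: coneZ => //; apply/xC/ballxx.
have nu : 0 < `|u| by rewrite normr_gt0.
have ku : 0 < 2 / e * `|u| by rewrite mulr_gt0.
apply/cone_leZV => //; apply: xC; rewrite -ball_normE /= opprB addrC subrK.
rewrite normrZ [X in X * _]gtr0_norm ?invr_gt0// invfM -mulrA mulVf ?gt_eqF//.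
by rewrite mulr1 invf_div ltr_pdivrMr// ltr_pMr// ltr1n.
Qed.

(** If 0 is interior then [C] is the whole space, which pointedness allows only for the zero space.
    In a nontrivial space, interior points are therefore nonzero. *)
Lemma interior_cone0_trivial (x : X) : C° x -> x = 0 -> forall y : X, y = 0.
Proof.
move=> /interior_cone_absorb[k _ h] x0 y.
have CN u : C (- u) by have := h u; rewrite x0 scaler0 /cone_le sub0r.
by apply: cone_anti; rewrite // -[y]opprK.
Qed.

End ProperCone.

(* [cone_close C T x y] encodes [d(x, y) <= ln T] for Thompson's metric d. *)
Definition cone_close (R : realType) (X : normedModType R) (C : set X) (T : R)
    (x y : X) : Prop :=
  cone_le C x (T *: y) /\ cone_le C y (T *: x).

Lemma cone_closeC (R : realType) (X : normedModType R) (C : set X) (T : R)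
    (x y : X) : cone_close C T x y -> cone_close C T y x.
Proof. by case. Qed.

(** * Thompson's metric as a pair of order inequalities *)

Section Thompson.
Context (R : realType) (X : normedModType R) (C : set X).
Hypothesis normalC : normal_cone C.

Let properC : proper_cone C. Proof. by case: normalC. Qed.

Lemma cone_m_has_ubound (x y : X) : C x -> x != 0 ->
  has_ubound [set a : R | cone_le C (a *: x) y].
Proof.
(* Normality bounds the positive [a], through [0 <= a x <= y]; the maximum with 0 takes care of the
   others. *)
case: normalC => _ [M nM] Cx x0; exists (Num.max 0 (M * `|y| / `|x|)) => a /= ax.
rewrite le_max; have [//|a0/=] := leP a 0.
rewrite ler_pdivlMr ?normr_gt0//.
rewrite -[X in X * _]gtr0_norm// -normrZ; apply: nM => //.
by rewrite /cone_le subr0; apply: coneZ => //; exact: ltW.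
Qed.

(** Any [b] above the exponential of the distance exceeds the infimum, and [b^-1] lies below the
    supremum, so both inequalities hold with [b]; [cone_le_limr] passes to the limit. *)
Lemma thompson_close (x y : X) : C° x -> C° y -> x != 0 ->
  cone_close C (expR (thompson C x y)) x y.
Proof.
move=> xC yC x0; have Cx := interior_subset xC; have Cy := interior_subset yC.
set t := thompson C x y.
have Mt : ln (cone_M C y x) <= t by rewrite le_max lexx.
have mt : - ln (cone_m C y x) <= t by rewrite le_max lexx orbT.
split; apply: cone_le_limr => // b tb; have b0 := lt_trans (expR_gt0 t) tb.
- have [k k0 xy] := interior_cone_absorb properC yC.
  have kx : 0 < k * `|x| by rewrite mulr_gt0// normr_gt0.
  have Sk : cone_le C ((k * `|x|)^-1 *: x) y by apply/cone_leZV.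
  (* Positivity ensures that [ln (cone_m C y x)] is a true logarithm and not the default value 0. *)
  have m0 : 0 < cone_m C y x.
    apply: lt_le_trans (ub_le_sup (cone_m_has_ubound _ Cx x0) Sk).
    by rewrite invr_gt0.
  have bm : b^-1 < cone_m C y x.
    rewrite invf_plt ?posrE//; apply: le_lt_trans tb.
    by rewrite -(ler_ln (x := _^-1)) ?posrE ?invr_gt0 ?expR_gt0// lnV// expRK.
  have S0 : [set a : R | cone_le C (a *: x) y] !=set0 by exists (k * `|x|)^-1.
  have [a /= ay ba] := sup_gt S0 bm.
  apply/(cone_leZV properC _ _ b0); apply: (cone_le_trans properC _ ay).
  by apply: cone_leZl => //; exact: ltW.
- have [k k0 yx] := interior_cone_absorb properC xC.
  have Mb : cone_M C y x < b.
    apply: le_lt_trans tb; have [M0|M0] := leP (cone_M C y x) 0.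
      by apply: le_trans M0 _; exact: expR_ge0.
    by rewrite -ler_ln ?posrE ?expR_gt0// expRK.
  have S0 : [set a : R | cone_le C y (a *: x)] !=set0 by exists (k * `|y|); apply: yx.
  have [a /= ay ba] := inf_lt S0 Mb.
  by apply: (cone_le_trans properC ay); apply: cone_leZl => //; exact: ltW.
Qed.

Lemma close_thompson (T : R) (x y : X) : 1 <= T -> C x -> C y -> x != 0 ->
  y != 0 -> cone_close C T x y -> thompson C x y <= ln T.
Proof.
move=> T1 Cx Cy x0 y0 [xy yx]; have T0 : 0 < T by lra.
have lnT0 := ln_ge0 T1.
rewrite /thompson ge_max; apply/andP; split.
(* In the nonpositive case [ln] takes its default value 0, and [1 <= T] makes [ln T] nonnegative. *)
- have [M0|M0] := leP (cone_M C y x) 0; first by rewrite ln0.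
  rewrite ler_ln ?posrE//; apply: ge_inf => //; exists 0 => b /= yb.
  rewrite leNgt; apply/negP => b0; move/eqP: y0; apply.
  apply: (cone_anti properC Cy); rewrite -[- y]sub0r.
  apply: (cone_le_trans properC yb).
  by have := cone_leZl properC (ltW b0) Cx; rewrite scale0r.
- have h : T^-1 <= cone_m C y x.
    by apply: ub_le_sup; [exact: cone_m_has_ubound | apply/cone_leZV].
  rewrite lerNl -lnV ?posrE// ler_ln ?posrE ?invr_gt0//.
  by apply: lt_le_trans h; rewrite invr_gt0.
Qed.

End Thompson.

(** * Triangle inequality, convexity of balls, and contraction for [cone_close] *)

Section CloseCalculus.
Context (R : realType) (X : normedModType R) (C : set X).
Hypothesis properC : proper_cone C.

Lemma cone_close_trans (T U : R) (x y z : X) : 0 <= T -> 0 <= U ->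
  cone_close C T x y -> cone_close C U y z -> cone_close C (T * U) x z.
Proof.
move=> T0 U0 [xy yx] [yz zy]; split.
- by apply: (cone_le_trans properC xy); rewrite -scalerA; exact: cone_leZ.
- apply: (cone_le_trans properC zy); rewrite mulrC -scalerA; exact: cone_leZ.
Qed.

Lemma cone_close_le (T U : R) (x y : X) : C x -> C y -> T <= U ->
  cone_close C T x y -> cone_close C U x y.
Proof.
move=> Cx Cy TU [xy yx]; split.
- by apply: (cone_le_trans properC xy); exact: cone_leZl.
- by apply: (cone_le_trans properC yx); exact: cone_leZl.
Qed.

(** Both defining inequalities are linear in the second point, so Thompson balls are convex. *)
Lemma cone_close_conv (T t : R) (v x y : X) : 0 <= t <= 1 ->
  cone_close C T v x -> cone_close C T v y ->
  cone_close C T v ((1 - t) *: x + t *: y).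
Proof.
move=> /andP[t0 t1] [vx xv] [vy yv]; have t1' : 0 <= 1 - t by lra.
have vE (u : X) : u = (1 - t) *: u + t *: u by rewrite -scalerDl subrK scale1r.
split.
- rewrite [v in cone_le C v _]vE scalerDr !scalerA ![T * _]mulrC -!scalerA.
  by apply: cone_leD => //; exact: cone_leZ.
- by rewrite [T *: v]vE; apply: cone_leD => //; exact: cone_leZ.
Qed.

Lemma cone_close1 (x y : X) : cone_close C 1 x y -> x = y.
Proof. by rewrite /cone_close !scale1r => -[]; exact: cone_le_anti. Qed.

(* Convex combination with z makes a Thompson-nonexpansive map a strict
   contraction for T - 1, as long as K z dominates the image. *)
Lemma cone_close_contract (K t T : R) (x y z : X) :
  0 < K -> 0 < t < 1 -> 0 <= T ->
  cone_le C x (K *: z) -> cone_le C y (K *: z) -> cone_close C (1 + T) x y ->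
  cone_close C (1 + ((1 - t) * K / ((1 - t) * K + t)) * T)
    ((1 - t) *: x + t *: z) ((1 - t) *: y + t *: z).
Proof.
move=> K0 /andP[t0 t1] T0 xK yK [xy yx]; have a0 : 0 < 1 - t by lra.
have D0 : 0 < (1 - t) * K + t by rewrite addr_gt0// mulr_gt0.
(* This [k] solves [k * t = (1 - t) * (1 - k) * K]. Lowering the factor from [1 + T] to [1 + k * T]
   leaves a surplus [(1 - t) * T * (1 - k)] of [y']; since [y'] is below [K *: z], the extra
   [k * T * t] of [z] absorbs it exactly. *)
set k := (1 - t) * K / ((1 - t) * K + t).
have k1 : 0 <= 1 - k.
  by rewrite subr_ge0 ler_pdivrMr// mul1r lerDl ltW.
have half (x' y' : X) : cone_le C y' (K *: z) -> cone_le C x' ((1 + T) *: y') ->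
    cone_le C ((1 - t) *: x' + t *: z) ((1 + k * T) *: ((1 - t) *: y' + t *: z)).
  move=> y'K xy'.
  apply: (@cone_le_trans _ _ _ properC
      (((1 - t) * (1 + k * T)) *: y' + ((1 - t) * T * (1 - k)) *: y' + t *: z)).
    apply: cone_leD => //; last exact: cone_le_refl.
    rewrite -scalerDl.
    have -> : (1 - t) * (1 + k * T) + (1 - t) * T * (1 - k) = (1 - t) * (1 + T).
      by ring.
    by rewrite -scalerA; apply: cone_leZ => //; exact: ltW.
  rewrite scalerDr !scalerA.
  rewrite (_ : (1 + k * T) * t = (1 - t) * T * (1 - k) * K + t); last first.
    by rewrite /k; field; rewrite gt_eqF.
  rewrite scalerDl addrA [(1 + k * T) * _]mulrC.
  apply: cone_leD => //; last exact: cone_le_refl.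
  apply: cone_leD => //; first exact: cone_le_refl.
  rewrite -[_ *: z]scalerA; apply: cone_leZ => //.
  by rewrite !mulr_ge0// ltW.
by split; apply: half.
Qed.

End CloseCalculus.

(** * Norm bounds from normality, and approximate fixed points *)

Section NormalCone.
Context (R : realType) (X : normedModType R) (C : set X).
Hypothesis normalC : normal_cone C.

Let properC : proper_cone C. Proof. by case: normalC. Qed.

(** Adding [a *: v] places [x] between 0 and [(a + b) *: v], where normality applies; the shift
    costs the extra term in [|a|]. *)
Lemma normal_cone_norm_le : exists2 M : R, 0 <= M &
  forall (v x : X) (a b : R), cone_le C (- (a *: v)) x -> cone_le C x (b *: v) ->
    `|x| <= (M * `|a + b| + `|a|) * `|v|.
Proof.
case: normalC => _ [M nM]; exists `|M| => // v x a b ax xb.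
have -> : x = (x + a *: v) - a *: v by rewrite addrK.
apply: (le_trans (ler_normB _ _)); rewrite mulrDl -[`|a| * _]normrZ lerD2r.
rewrite -mulrA -[`|a + b| * _]normrZ.
apply: (@le_trans _ _ (M * `|(a + b) *: v|)); last first.
  by rewrite ler_wpM2r// ler_norm.
apply: nM; rewrite /cone_le ?subr0.
- by move: ax; rewrite /cone_le opprK.
- by rewrite scalerDl [a *: v + _]addrC opprD addrACA subrr addr0.
Qed.

(** The map [g = (1 - t) f + t z] contracts the order constants, so the steps between its successive
    iterates from [z] tend to 0. A late iterate is almost fixed by [g], hence by [f], which is
    within [t * N] of [g] on [S]. *)
Lemma approx_fixpoint (S : set X) (f : X -> X) (z : X) (K : R) :
  1 <= K -> S z -> S `<=` C ->
  (forall x y t, S x -> S y -> 0 <= t <= 1 -> S ((1 - t) *: x + t *: y)) ->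
  (forall x, S x -> cone_close C K z x) ->
  (forall x, S x -> S (f x)) ->
  (forall x y T, S x -> S y -> 1 <= T -> cone_close C T x y ->
    cone_close C T (f x) (f y)) ->
  forall eta : R, 0 < eta -> exists2 x, S x & `|x - f x| <= eta.
Proof.
move=> K1 Sz SC convS SK fS f_close eta eta0; have K0 : 0 < K by lra.
have [M M0 nM] := normal_cone_norm_le.
have normS x : S x -> `|x| <= M * K * `|z|.
  move=> Sx; have [_ xK] := SK _ Sx.
  have := nM z x 0 K; rewrite scale0r oppr0 add0r normr0 addr0 (gtr0_norm K0).
  by apply => //; rewrite /cone_le subr0; exact: SC.
set N := `|z| + M * K * `|z|.
have N0 : 0 <= N by rewrite addr_ge0// !mulr_ge0// ltW.
(* [N] bounds the norm of [z - f x] on [S], so this choice makes [g] and [f] differ by at most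
   [eta / 2]; [N + 1] avoids a zero denominator. *)
pose t := Num.min 2^-1 (eta / 2 / (N + 1)).
have t0 : 0 < t by rewrite lt_min invr_gt0 ltr0n/= divr_gt0 ?ltr_wpDl// divr_gt0.
have t1 : t < 1.
  have : t <= 2^-1 by rewrite ge_min lexx.
  by lra.
have tN : t * N <= eta / 2.
  have : t <= eta / 2 / (N + 1) by rewrite ge_min lexx orbT.
  rewrite ler_pdivlMr ?ltr_wpDl// => h; apply: le_trans h.
  by rewrite ler_pM2l// lerDl.
have t01 : 0 < t < 1 by apply/andP.
have t01' : 0 <= t <= 1 by rewrite !ltW.
pose g x := (1 - t) *: f x + t *: z.
pose k := (1 - t) * K / ((1 - t) * K + t).
have aK0 : 0 < (1 - t) * K by rewrite mulr_gt0// subr_gt0.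
have k0 : 0 <= k by rewrite divr_ge0// ltW// addr_gt0.
have k1 : k < 1 by rewrite ltr_pdivrMr ?addr_gt0// mul1r ltrDl.
have gS x : S x -> S (g x) by move=> Sx; apply: convS => //; exact: fS.
have Sn n : S (iter n g z) by elim: n => //= n; exact: gS.
have close_n n :
    cone_close C (1 + k ^+ n * (K - 1)) (iter n g z) (iter n.+1 g z).
  elim: n => [|n IH]; first by rewrite expr0 mul1r addrC subrK; exact: SK.
  rewrite exprS -mulrA.
  have T0 : 0 <= k ^+ n * (K - 1) by rewrite mulr_ge0 ?exprn_ge0// subr_ge0.
  apply: cone_close_contract => //.
  - by case: (SK _ (fS _ (Sn n))).
  - by case: (SK _ (fS _ (Sn n.+1))).
  - by apply: f_close (Sn n) (Sn n.+1) _ IH; rewrite lerDl.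
(* With [T = k ^+ n * (K - 1)], the difference of consecutive iterates lies between [- (T * K) *: z]
   and [(T * K) *: z], because both iterates are below [K *: z]. *)
have step_le n : `|iter n g z - iter n.+1 g z| <=
    k ^+ n * ((K - 1) * K * (M * 2 + 1) * `|z|).
  have [xy yx] := close_n n.
  have [_ xK] := SK _ (Sn n); have [_ yK] := SK _ (Sn n.+1).
  move: xy yx xK yK.
  set x := iter n g z; set y := iter n.+1 g z; set T := k ^+ n * (K - 1).
  have T0 : 0 <= T by rewrite mulr_ge0 ?exprn_ge0// subr_ge0.
  have TK0 : 0 <= T * K by rewrite mulr_ge0// ltW.
  rewrite !scalerDl !scale1r => xy yx xK yK.
  have := nM z (x - y) (T * K) (T * K).
  rewrite -mulr2n !ger0_norm ?mulrn_wge0// => h.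
  apply: (le_trans (h _ _)).
  - apply: (@cone_le_trans _ _ _ properC (- (T *: x))).
      by apply: cone_leN; rewrite -[(T * K) *: z]scalerA; exact: cone_leZ.
    by move: yx; rewrite /cone_le opprK addrAC addrC addrA.
  - apply: (@cone_le_trans _ _ _ properC (T *: y)).
      by move: xy; rewrite /cone_le opprB addrCA addrA.
    by rewrite -[(T * K) *: z]scalerA; exact: cone_leZ.
  - rewrite le_eqVlt; apply/orP; left; apply/eqP; rewrite -mulr_natr /T; ring.
move: ((K - 1) * K * (M * 2 + 1) * `|z|) step_le => B step_le.
have [n /ltW hn] : exists n, k ^+ n * B < eta / 2.
  have : (fun n => k ^+ n * B) @ \oo --> 0 * B.
    by apply: cvgMr_tmp; apply: cvg_expr; rewrite ger0_norm.
  rewrite mul0r => /cvgrPdist_lt/(_ (eta / 2)); rewrite divr_gt0// => /(_ isT).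
  move=> [n _ /(_ n (leqnn n))]; rewrite /= sub0r normrN => h.
  by exists n; exact: le_lt_trans (ler_norm _) h.
exists (iter n g z) => //.
rewrite -(subrKA (iter n.+1 g z)).
apply: (le_trans (ler_normD _ _)); rewrite [leRHS]splitr.
apply: lerD; first exact: le_trans (step_le n) hn.
apply: le_trans tN; rewrite iterS; set x := iter n g z.
have -> : g x - f x = t *: (z - f x).
  by rewrite /g scalerBl scale1r addrAC [f x - _]addrC addrK addrC -scalerBr.
rewrite normrZ gtr0_norm// ler_pM2l//.
by apply: (le_trans (ler_normB _ _)); rewrite lerD2l; apply/normS/fS; exact: Sn.
Qed.

End NormalCone.

(** * Thompson geometry around [v], compared with the norm *)

(** A geodesic from [v] to [w] runs through combinations [p *: w + q *: v]. Two linear equations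
    match the comparison with [v]; the resulting [p] and [q] also give the factor [A / r] with
    respect to [w]. *)
Lemma cone_close_between (R : realType) (X : normedModType R) (C : set X)
    (A r : R) (v w : X) :
  proper_cone C -> 1 < A -> 1 <= r <= A -> cone_close C A v w ->
  exists z, cone_close C r v z /\ cone_close C (A / r) w z.
Proof.
move=> properC A1 /andP[r1 rA] [vw wv].
have A0 : 0 < A by lra.
have r0 : 0 < r by lra.
have An0 : A != 0 by rewrite gt_eqF.
have rn0 : r != 0 by rewrite gt_eqF.
have D0 : 0 < A ^+ 2 - 1 by nra.
have Dn0 : A ^+ 2 - 1 != 0 by rewrite gt_eqF.
(* p and q solve p * A + q = r and p / A + q = 1 / r. *)
pose p := (r - r^-1) / (A - A^-1); pose q := (A / r - r / A) / (A - A^-1).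
(* In these forms [1 <= r <= A] shows that both coefficients are nonnegative. *)
have pE : p = (A * (r ^+ 2 - 1)) / (r * (A ^+ 2 - 1)).
  by rewrite /p; field; rewrite ?rn0 ?An0 ?Dn0.
have qE : q = (A ^+ 2 - r ^+ 2) / (r * (A ^+ 2 - 1)).
  by rewrite /q; field; rewrite rn0 An0 Dn0.
have rD0 : 0 <= r * (A ^+ 2 - 1) by rewrite ltW// mulr_gt0.
have p0 : 0 <= p by rewrite pE divr_ge0//; nra.
have q0 : 0 <= q by rewrite qE divr_ge0//; nra.
exists (p *: w + q *: v); split; split.
- apply/(cone_leZV properC _ _ r0).
  have -> : r^-1 *: v = p *: (A^-1 *: v) + q *: v.
    rewrite scalerA -scalerDl; congr (_ *: _); rewrite pE qE; field.
    by rewrite rn0 An0 Dn0.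
  apply: cone_leD => //; last exact: cone_le_refl.
  by apply: cone_leZ => //; apply/cone_leZV.
- have -> : r *: v = p *: (A *: v) + q *: v.
    rewrite scalerA -scalerDl; congr (_ *: _); rewrite pE qE; field.
    by rewrite rn0 Dn0.
  apply: cone_leD => //; last exact: cone_le_refl.
  exact: cone_leZ.
- apply/(cone_leZV properC); first by rewrite divr_gt0.
  have -> : (A / r)^-1 *: w = p *: w + q *: (A^-1 *: w).
    rewrite scalerA -scalerDl; congr (_ *: _); rewrite pE qE; field.
    by rewrite rn0 An0 Dn0.
  apply: cone_leD => //; first exact: cone_le_refl.
  by apply: cone_leZ => //; apply/cone_leZV.
- have -> : (A / r) *: w = p *: w + q *: (A *: w).
    rewrite scalerA -scalerDl; congr (_ *: _); rewrite pE qE; field.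
    by rewrite rn0 Dn0.
  apply: cone_leD => //; first exact: cone_le_refl.
  exact: cone_leZ.
Qed.

(** The inequalities read [(1 - s) v <= x <= (1 - s)^-1 v], and [(1 - s)^-1 <= 1 + 2 s] for
    [s <= 1/2]. Thus [x - v] lies between [- s v] and [2 s v], and normality applies. *)
Lemma cone_close_norm_le (R : realType) (X : normedModType R) (C : set X)
    (v : X) : normal_cone C -> C v ->
  exists2 K : R, 0 < K & forall (s : R) (x : X), 0 <= s <= 2^-1 ->
    cone_close C (1 - s)^-1 v x -> `|x - v| <= K * s.
Proof.
move=> normalC Cv; have [properC _] := normalC.
have [M M0 nM] := normal_cone_norm_le normalC.
exists ((M * 3 + 1) * `|v| + 1) => [|s x /andP[s0 s2] [vx xv]].
  by rewrite ltr_wpDl// mulr_ge0// addr_ge0// mulr_ge0.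
have s1 : 0 < 1 - s by lra.
have h1 : cone_le C (- (s *: v)) (x - v).
  move: vx => /(cone_leZV properC); rewrite invr_gt0 => /(_ s1).
  by rewrite invrK /cone_le scalerBl scale1r opprK opprB [s *: v - v]addrC addrA.
have h2 : cone_le C (x - v) ((2 * s) *: v).
  have : cone_le C x ((1 + 2 * s) *: v).
    apply: (cone_le_trans properC xv); apply: cone_leZl => //.
    by rewrite -[leLHS]mul1r ler_pdivrMr//; nra.
  by rewrite /cone_le scalerDl scale1r opprB -addrA addrCA.
apply: (le_trans (nM _ _ _ _ h1 h2)).
rewrite !ger0_norm//; last by lra.
have : 0 <= `|v| by [].
nra.
Qed.

(** If [x] were too near [v] in norm, absorption by the interior point [v] would make it
    [(1 - n)^-1]-close to [v] with [n < s]. Going from [v] to [w] through [x] would then beat the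
    minimal constant [A]. *)
Lemma cone_close_norm_ge (R : realType) (X : normedModType R) (C : set X)
    (v : X) : proper_cone C -> C° v ->
  exists2 k : R, 0 < k & forall (A s : R) (w x : X), 1 <= A -> s < 1 ->
    1 <= A * (1 - s) ->
    cone_close C (A * (1 - s)) w x ->
    (forall T, 1 <= T -> cone_close C T v w -> A <= T) ->
    k * s <= `|x - v|.
Proof.
move=> properC vC; have [k k0 kv] := interior_cone_absorb properC vC.
exists k^-1 => [|A s w x A1 s1 As wx Amin]; first by rewrite invr_gt0.
rewrite ler_pdivrMl// leNgt; apply/negP; set n := k * _ => ns.
have n0 : 0 <= n by rewrite mulr_ge0// ltW.
have n1 : 0 < 1 - n by lra.
have vx : cone_close C (1 - n)^-1 v x.
  split.
    apply/cone_leZV; rewrite ?invr_gt0// invrK scalerBl scale1r.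
    have := kv (v - x); rewrite distrC -/n /cone_le opprB.
    by rewrite addrA [n *: v + x]addrC -addrA -(opprB v).
  apply: (@cone_le_trans _ _ _ properC ((1 + n) *: v)).
    have := kv (x - v); rewrite -/n /cone_le opprB scalerDl scale1r.
    by rewrite addrCA addrA.
  apply: cone_leZl => //; last exact: interior_subset.
  by rewrite -[leRHS]mul1r ler_pdivlMr//; nra.
have AT : A <= (1 - n)^-1 * (A * (1 - s)).
  apply: Amin; first by rewrite mulrC ler_pdivlMr//; lra.
  apply: (cone_close_trans properC _ _ vx (cone_closeC wx)); last by lra.
  by rewrite invr_ge0 ltW.
by move: AT; rewrite mulrC ler_pdivlMr//; nra.
Qed.

(** * From nonexpansiveness of [f] to approximate fixed points of its semidifferential *)

Lemma thompson_nonexpansive_close (R : realType) (X : normedModType R)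
    (C G : set X) (f : X -> X) (T : R) (x y : X) :
  normal_cone C -> (exists u : X, u != 0) -> G `<=` C° ->
  (forall x, G x -> C° (f x)) -> thompson_nonexpansive C G f ->
  G x -> G y -> 1 <= T -> cone_close C T x y -> cone_close C T (f x) (f y).
Proof.
move=> normalC [u u0] GC fC nonexp Gx Gy T1 xy; have [properC _] := normalC.
have neq0 z : C° z -> z != 0.
  move=> zC; apply: contra_neq u0 => z0.
  exact: (interior_cone0_trivial properC zC z0).
have sub := @interior_subset _ C.
have T0 : 0 < T by lra.
have := thompson_close normalC (fC _ Gx) (fC _ Gy) (neq0 _ (fC _ Gx)).
apply: cone_close_le => //; [exact/sub/fC|exact/sub/fC|].
rewrite -(lnK (x := T)) ?posrE// ler_expR; apply: (le_trans (nonexp _ _ Gx Gy)).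
apply: close_thompson => //; [exact/sub/GC|exact/sub/GC| |]; exact/neq0/GC.
Qed.

(** The constants [k] and [K] do not depend on [eta]: both norm estimates are linear in [s], so
    division by [s] leaves the points in a fixed shell. *)
Lemma semidifferential_approx_fixpoint (R : realType) (X : normedModType R)
    (C G : set X) (f h : X -> X) (v w : X) :
  normal_cone C -> open G -> G `<=` C -> (forall x, G x -> C° (f x)) ->
  thompson_nonexpansive C G f -> G v -> G w -> f v = v -> f w = w ->
  v != w -> is_semidifferential G f v h ->
  exists k K : R, 0 < k /\ forall eta : R, 0 < eta ->
    exists u : X, [/\ k <= `|u|, `|u| <= K & `|u - h u| <= eta].
Proof.
move=> normalC openG GC fC nonexp Gv Gw fv fw vw [_ _ homh dfv].
have [properC _] := normalC.
have GC' : G `<=` C° by move=> x Gx; apply: filterS GC _; exact: open_nbhs_nbhs.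
have X0 : exists u : X, u != 0.
  have [v0|v0] := eqVneq v 0; last by exists v.
  by exists w; rewrite eq_sym -v0.
have f_close x y T := @thompson_nonexpansive_close _ _ _ _ _ T x y
  normalC X0 GC' fC nonexp.
have neq0 z : G z -> z != 0.
  move=> /GC' zC; case: X0 => u; apply: contra_neq => z0.
  exact: (interior_cone0_trivial properC zC z0).
pose A := expR (thompson C v w).
have vwA : cone_close C A v w.
  by apply: thompson_close (GC' _ Gv) (GC' _ Gw) (neq0 _ Gv).
have A0 : 0 < A by exact: expR_gt0.
(* This minimality of [A] is what keeps the points of [S] away from [v]. *)
have Amin T : 1 <= T -> cone_close C T v w -> A <= T.
  move=> T1 vwT; have T0 : 0 < T by lra.
  rewrite -(lnK (x := T)) ?posrE// ler_expR.
  by apply: close_thompson => //; [exact: GC|exact: GC|exact: neq0|exact: neq0].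
have A1 : 1 < A.
  rewrite ltNge; apply/negP => A1; move/eqP: vw; apply.
  apply: (cone_close1 properC).
  by apply: cone_close_le A1 vwA => //; exact: GC.
have [K K0 normK] := cone_close_norm_le normalC (GC _ Gv).
have [k k0 normk] := cone_close_norm_ge properC (GC' _ Gv).
exists k, K; split=> // eta eta0.
have : \forall x \near v, G x by exact: open_nbhs_nbhs.
move=> /nbhs_normP[d1 /= d10 Gd1].
(* Since [|x - v| <= K * s] on [S], this coefficient makes the remainder of the expansion at most
   [s * (eta / 2)]. *)
have e0 : 0 < eta / 2 / K by rewrite !divr_gt0.
have /nbhs_normP[d2 /= d20 fd2] : \forall x \near (0 : X),
    `|f (x + v) - (v + h x)| <= eta / 2 / K * `|x|.
  have := (iffLR (eqaddoP _ _ _ _) dfv) _ e0.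
  by apply: filterS => x /=; rewrite fv.
(* The four bounds serve, in order, the upper norm estimate, the inequality [1 <= A * (1 - s)], the
   inclusion of [S] in [G], and the validity of the expansion on [S]. *)
pose s := Num.min (Num.min 2^-1 (1 - A^-1)) (Num.min (d1 / 2 / K) (d2 / 2 / K)).
have s0 : 0 < s.
  rewrite !lt_min invr_gt0 ltr0n subr_gt0 invf_lt1// A1 /=.
  by rewrite !divr_gt0.
have [s2 sA sd1 sd2] : [/\ s <= 2^-1, s <= 1 - A^-1, s <= d1 / 2 / K & s <= d2 / 2 / K].
  by split; rewrite !ge_min lexx ?orbT.
have s1 : 0 < 1 - s by lra.
have As : 1 <= A * (1 - s).
  by rewrite -(ler_pdivrMl _ _ A0) mulr1; lra.
have r1 : 1 <= (1 - s)^-1 by rewrite -[leRHS]mul1r ler_pdivlMr//; lra.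
(* The two constants multiply to [A], so [S] consists of points on geodesics from [v] to [w], at
   distance [- ln (1 - s)] from [v]. *)
pose S x := cone_close C (1 - s)^-1 v x /\ cone_close C (A * (1 - s)) w x.
have Snorm x : S x -> k * s <= `|x - v| /\ `|x - v| <= K * s.
  move=> [vx wx]; split; last by apply: normK => //; apply/andP; split => //; exact: ltW.
  by apply: (normk A s w x) => //; [exact: ltW|lra].
have Sd x d : s <= d / 2 / K -> 0 < d -> S x -> `|x - v| < d.
  move=> sd d0 /Snorm[_ xv]; apply: (le_lt_trans xv).
  by rewrite mulrC; move: sd; rewrite ler_pdivlMr// => sd; lra.
have SG x : S x -> G x.
  by move=> Sx; apply: Gd1; rewrite /= distrC; exact: Sd Sx.
have [z Sz] : exists z, S z.
  have := @cone_close_between _ _ _ A (1 - s)^-1 v w properC A1.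
  rewrite invrK; apply => //; rewrite r1/=.
  by rewrite -[leLHS]mul1r ler_pdivrMr.
have KS x : S x -> cone_close C ((1 - s)^-1 * (1 - s)^-1) z x.
  move=> [vx _]; apply: (cone_close_trans properC _ _ (cone_closeC Sz.1) vx); lra.
(* [S] is an intersection of balls centred at the fixed points [v] and [w], which nonexpansiveness
   preserves. *)
have fS x : S x -> S (f x).
  move=> Sx; have Gx := SG _ Sx; case: Sx => vx wx.
  by split; [rewrite -fv|rewrite -fw]; exact: f_close.
have [x Sx fx] : exists2 x, S x & `|x - f x| <= s * (eta / 2).
  apply: (approx_fixpoint normalC (K := (1 - s)^-1 * (1 - s)^-1) _ Sz) => //.
  - by rewrite mulr_ege1.
  - by move=> x Sx; exact/GC/SG.
  - move=> x y t [vx wx] [vy wy] t01.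
    by split; exact: cone_close_conv.
  - by move=> x y T /SG Gx /SG Gy; exact: f_close.
  - by rewrite mulr_gt0// divr_gt0.
have [kx xK] := Snorm _ Sx.
exists (s^-1 *: (x - v)).
have sV0 : 0 < s^-1 by rewrite invr_gt0.
rewrite homh// -scalerBr !normrZ !(gtr0_norm sV0) !(mulrC s^-1).
split; [by rewrite ler_pdivlMr|by rewrite ler_pdivrMr|].
rewrite ler_pdivrMr//.
have := fd2 (x - v); rewrite /= sub0r normrN subrK => /(_ (Sd _ _ sd2 d20 Sx)) fxv.
(* The first term is small because [x] is almost fixed by [f], the second because it is the
   remainder of the expansion; each is at most [s * (eta / 2)]. *)
have -> : x - v - h (x - v) = (x - f x) + (f x - (v + h (x - v))).
  by rewrite addrA subrK opprD addrA.
apply: (le_trans (ler_normD _ _)).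
apply: (le_trans (lerD fx fxv)).
rewrite [eta in leRHS]splitr mulrDl mulrC lerD2l -mulrA ler_pM2l ?divr_gt0//.
by rewrite ler_pdivrMl.
Qed.

Theorem theorem7p1 (R : realType) (X : completeNormedModType R)
    (C G : set X) (f f'v : X -> X) (v : X)
    (normalC : normal_cone C) (intC : C° !=set0)
    (openG : open G) (subGC : G `<=` C)
    (fG : forall x, G x -> C° (f x))
    (f_nonexp : thompson_nonexpansive C G f)
    (Gv : G v) (fv : f v = v)
    (A1 : is_semidifferential G f v f'v)
    (A2 : property_F [set: X] (fun x => x - f'v x))
    (A3 : forall x, f'v x = x -> x = 0) :
  forall w, G w -> f w = w -> w = v.

Proof.
move=> w Gw fw; apply/eqP; rewrite eq_sym; apply/negPn/negP => vw.
have [k [K [k0 approx]]] := semidifferential_approx_fixpoint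
  normalC openG subGC fG f_nonexp Gv Gw fv fw vw A1.
have /choice[u uP] (n : nat) : exists u : X,
    [/\ k <= `|u|, `|u| <= K & `|u - f'v u| <= n.+1%:R^-1].
  by apply: approx; rewrite invr_gt0.
have ubd : bounded_fun u.
  exists K; split; first exact: num_real.
  by move=> L KL n _ /=; case: (uP n) => _ uK _; apply: le_trans uK (ltW KL).
have gu : ((fun x => x - f'v x) \o u) @ \oo --> (0 : X).
  apply/cvgr0Pnorm_le => e e0; have := near_infty_natSinv_lt (PosNum e0).
  apply: filterS => n /= ne; case: (uP n) => _ _ un.
  by apply: (le_trans un); exact: ltW.
have [phi phi_incr /cvg_ex[l ul]] := A2 u (fun=> I) ubd gu.
have phi_ge n : (n <= phi n)%N.
  elim: n => // n /leq_ltn_trans; apply.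
  by have /increasing_seqP := phi_incr; apply.
have phi_oo : phi @ \oo --> \oo.
  by move=> P [N _ NP]; exists N => // n /= Nn; apply/NP/(leq_trans Nn)/phi_ge.
have [_ contf _ _] := A1.
(* Continuity of [f'v] gives this limit; along the same subsequence the values tend to 0, so [l] is
   a fixed point of [f'v]. *)
have gl : ((fun x => x - f'v x) \o u) \o phi @ \oo --> l - f'v l.
  by apply: cvgB => //; exact: continuous_cvg (contf l) ul.
have lfix : l - f'v l = 0.
  have g0 := cvg_comp _ _ phi_oo gu.
  exact: (cvg_unique (@norm_hausdorff _ X) gl g0).
(* The uniform lower bound survives in the limit and contradicts [l = 0], which [A3] imposes. *)
have : k <= `|l|.
  apply: (closed_cvg _ (@closed_ge _ k) _ _ (cvg_norm ul)).
  by apply: nearW => n /=; case: (uP (phi n)).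
rewrite (A3 _ (esym (subr0_eq lfix))) normr0 => k_le0.
by move: k0; rewrite ltNge k_le0.
Qed.
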